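(* Let $I:=\{1,\dots,m\}$, let $g_i\colon\mathbb{R}^n\to\mathbb{R}$, $i\in I$, be lower semicontinuous functions, and let $\Omega\subset\mathbb{R}^n$ be an unbounded closed set such that $\Omega\cap\big(\bigcap_{i\in I}\mathrm{dom}\,g_i\big)$ is unbounded. Let $$S:=\{x\in\Omega : g_i(x)\le 0,\ i=1,\dots,m\}.$$ Suppose that the following two conditions hold: (1) whenever $u_i\in\partial^\infty g_i(\infty)$ for $i\in I$, $v\in N(\infty;\Omega)$ and $u_1+\dots+u_m+v=0$, one has $v=0$ and $u_i=0$ for all $i\in I$; (2) there is no $\lambda\in\Delta_m$ such that $0\in\sum_{i=1}^m\lambda_i\circ\partial g_i(\infty)+N(\infty;\Omega)$. Then $S$ has an error bound at infinity, i.e., there exist $\alpha>0$ and $R>0$ such that $$d(x;S)\le\alpha\sum_{i=1}^m[g_i(x)]_+\quad\text{for all } x\in\Omega\text{ with }\|x\|>R.$$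
   Context: $\mathbb{R}^n$ carries the Euclidean norm; $d(x;S):=\inf\{\|y-x\| : y\in S\}$; $[t]_+:=\max\{t,0\}$; $\mathrm{dom}\,f:=\{x : f(x)<+\infty\}$; $\mathrm{epi}\,f:=\{(x,\alpha)\in\mathbb{R}^n\times\mathbb{R} : \alpha\ge f(x)\}$; $\Delta_m:=\{\lambda\in\mathbb{R}^m : \lambda_i\ge 0,\ \sum_{i=1}^m\lambda_i=1\}$. Normal cones. For $C\subset\mathbb{R}^d$ and $\bar x\in C$, the Fréchet normal cone is $\widehat N(\bar x;C):=\{v\in\mathbb{R}^d : \limsup_{x\to\bar x,\,x\in C}\langle v,x-\bar x\rangle/\|x-\bar x\|\le 0\}$. The limiting normal cone $N(\bar x;C)$ is the set of all $v$ for which there exist $x_k\in C$, $x_k\to\bar x$, and $v_k\in\widehat N(x_k;C)$ with $v_k\to v$. Normal cone at infinity. For an unbounded closed $\Omega\subset\mathbb{R}^n$, $N(\infty;\Omega)$ is the set of all $v$ for which there exist $x_k\in\Omega$ with $\|x_k\|\to\infty$ and $v_k\in\widehat N(x_k;\Omega)$ with $v_k\to v$. Subdifferentials at infinity. For a lower semicontinuous $f\colon\mathbb{R}^n\to\mathbb{R}\cup\{+\infty\}$ with unbounded domain, let $\mathcal{N}$ be the set of all $w\in\mathbb{R}^n\times\mathbb{R}$ for which there exist $x_k\in\mathrm{dom}\,f$ with $\|x_k\|\to\infty$ and $w_k\in N((x_k,f(x_k));\mathrm{epi}\,f)$ with $w_k\to w$. Then $\partial f(\infty):=\{u : (u,-1)\in\mathcal{N}\}$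 and $\partial^\infty f(\infty):=\{u : (u,0)\in\mathcal{N}\}$. For $\lambda\ge0$: $\lambda\circ\partial f(\infty):=\lambda\,\partial f(\infty)$ if $\lambda>0$, and $0\circ\partial f(\infty):=\partial^\infty f(\infty)$. Sums of sets are Minkowski sums (empty if a summand is empty).
   Formalization: The distance d(x;S) is taken to be 0 when S is empty, so the error bound is claimed only for nonempty S; with inf of the empty set equal to +∞ the claim fails, e.g. for Ω = ℝ, m = 1, g(x) = 1 + |x|. *)

(* Defs.v *)
(* R^n is 'rV[R]_n with its canonical (product) topology. *)
From mathcomp Require Import all_boot all_order all_algebra.
From mathcomp Require Import all_classical all_reals all_analysis.

Set Implicit Arguments.
Unset Strict Implicit.
Unset Printing Implicit Defensive.

Import Order.TTheory GRing.Theory Num.Theory.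
Import numFieldNormedType.Exports.

Local Open Scope classical_set_scope.
Local Open Scope ring_scope.

Definition dot (R : realType) (d : nat) (u v : 'rV[R]_d) : R :=
  \sum_(i < d) u 0 i * v 0 i.

(* The library norm `|x| on row vectors is the max norm, hence this one. *)
Definition enorm (R : realType) (d : nat) (x : 'rV[R]_d) : R :=
  Num.sqrt (dot x x).

(* Real-valued, as an error bound presupposes: inf set0 = 0 in the library, so
   dist_to x set0 = 0. With the value +oo instead, an infeasible system such as
   1 + |x| <= 0 would violate every error bound. *)
Definition dist_to (R : realType) (d : nat) (x : 'rV[R]_d) (S : set 'rV[R]_d) : R :=
  inf [set enorm (y - x) | y in S].

Definition unbounded (R : realType) (d : nat) (A : set 'rV[R]_d) : Prop :=
  forall M : R, exists2 x, A x & M < enorm x.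

(* The limsup is over x <> xbar in C; it is -oo when xbar is isolated in C. *)
Definition frechet_normal_cone (R : realType) (d : nat)
    (xbar : 'rV[R]_d) (C : set 'rV[R]_d) : set 'rV[R]_d :=
  [set v | (limf_esup (fun x : 'rV[R]_d => (dot v (x - xbar) / enorm (x - xbar))%:E)
                      (within C xbar^') <= 0)%E].

Definition limiting_normal_cone (R : realType) (d : nat)
    (xbar : 'rV[R]_d) (C : set 'rV[R]_d) : set 'rV[R]_d :=
  [set v | exists x_ v_ : nat -> 'rV[R]_d,
    [/\ forall k, C (x_ k),
        x_ @ \oo --> xbar,
        forall k, frechet_normal_cone (x_ k) C (v_ k) &
        v_ @ \oo --> v]].

Definition normal_cone_infty (R : realType) (d : nat)
    (Omega : set 'rV[R]_d) : set 'rV[R]_d :=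
  [set v | exists x_ v_ : nat -> 'rV[R]_d,
    [/\ forall k, Omega (x_ k),
        enorm (x_ k) @[k --> \oo] --> +oo,
        forall k, frechet_normal_cone (x_ k) Omega (v_ k) &
        v_ @ \oo --> v]].

(* The point (x, a) of R^n x R, seen in R^(n + 1). *)
Definition pt (R : realType) (n : nat) (x : 'rV[R]_n) (a : R) : 'rV[R]_(n + 1) :=
  row_mx x a%:M.

Definition edom (R : realType) (n : nat) (f : 'rV[R]_n -> \bar R) : set 'rV[R]_n :=
  [set x | (f x < +oo)%E].

Definition epi (R : realType) (n : nat) (f : 'rV[R]_n -> \bar R) :
    set 'rV[R]_(n + 1) :=
  [set w | exists x a, w = pt x a /\ (f x <= a%:E)%E].

(* Meant for f with values in R u {+oo}: then fine (f x) is f x on edom f. *)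
Definition epi_normals_infty (R : realType) (n : nat) (f : 'rV[R]_n -> \bar R) :
    set 'rV[R]_(n + 1) :=
  [set w | exists (x_ : nat -> 'rV[R]_n) (w_ : nat -> 'rV[R]_(n + 1)),
    [/\ forall k, edom f (x_ k),
        enorm (x_ k) @[k --> \oo] --> +oo,
        forall k, limiting_normal_cone (pt (x_ k) (fine (f (x_ k)))) (epi f) (w_ k) &
        w_ @ \oo --> w]].

Definition subdiff_infty (R : realType) (n : nat) (f : 'rV[R]_n -> \bar R) :
    set 'rV[R]_n :=
  [set u | epi_normals_infty f (pt u (-1))].

Definition singular_subdiff_infty (R : realType) (n : nat)
    (f : 'rV[R]_n -> \bar R) : set 'rV[R]_n :=
  [set u | epi_normals_infty f (pt u 0)].

Definition circ_subdiff_infty (R : realType) (n : nat) (lam : R)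
    (f : 'rV[R]_n -> \bar R) : set 'rV[R]_n :=
  if 0 < lam then [set lam *: u | u in subdiff_infty f]
  else singular_subdiff_infty f.

Definition minkowski_sum (R : realType) (n m : nat) (A : 'I_m -> set 'rV[R]_n) :
    set 'rV[R]_n :=
  [set \sum_(i < m) u i | u in [set u : 'I_m -> 'rV[R]_n | forall i, A i (u i)]].

Definition simplex (R : realType) (m : nat) : set ('I_m -> R) :=
  [set lam | (forall i, 0 <= lam i) /\ \sum_(i < m) lam i = 1].

Definition solution_set (R : realType) (n m : nat) (Omega : set 'rV[R]_n)
    (g : 'I_m -> 'rV[R]_n -> R) : set 'rV[R]_n :=
  [set x | Omega x /\ forall i, g i x <= 0].

(* Main.v *)
Require Import Defs.
From mathcomp Require Import all_boot all_order all_algebra.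
From mathcomp Require Import all_classical all_reals all_analysis.
From mathcomp Require Import ring lra.
Import Order.TTheory GRing.Theory Num.Theory.
Import numFieldNormedType.Exports.
Local Open Scope classical_set_scope.
Local Open Scope ring_scope.

Set Implicit Arguments.
Unset Strict Implicit.
Unset Printing Implicit Defensive.

(** If the error bound fails, there are points x0 of Omega, arbitrarily far out,
whose distance d to the solution set S exceeds any prescribed multiple of their
total violation; say that this violation is at most eps * d with eps small. Near
such a point one minimises, over x in Omega and over independent copies
y_i of x,

  |([g_i(y_i)]_+)_i| + c |x - x0|^2 + rho \sum_i |y_i - x|^2,

where |.| is Euclidean. With c = 4 eps / d, comparison with the value at x0 gives
|x - x0| <= d / 2, so x is still far from S; with rho large, the y_i are
so close to x that, by lower semicontinuity and closedness of Omega, some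
g_i(y_i) is positive ([infeasible_near]). The norm of the violations is then
differentiable at the minimiser, and the copies decouple the constraints: without
any sum rule, each g_i contributes a proximal normal (u_i, - lam_i) to its epigraph
at (y_i, g_i(y_i)) with u_i = 2 rho (x - y_i), and Omega contributes the proximal normal
v = - 2 c (x - x0) - \sum_i u_i at x. Here \sum_i lam_i >= 1, since lam is
a Euclidean unit vector with nonnegative entries, and |\sum_i u_i + v| <= 4 eps
([approximate_multipliers]).

Now x0 goes to infinity and eps to 0. Since d <= |x0| + |s0| for a fixed s0 in S,
the bound |x - x0| <= d / 2 forces x and the y_i to infinity too. The cones
allow the multipliers to be divided by \sum_i lam_i + \sum_i |u_i|,
so a subsequence converges to a nonzero (lam, u) with (u_i, - lam_i)
normal to the epigraph of g_i at infinity and - \sum_i u_i normal to Omega at infinity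
([no_error_bound_multipliers]). If lam = 0, this contradicts the qualification
condition; otherwise dividing by \sum_i lam_i contradicts the absence
of multipliers in the simplex. *)

(** * Euclidean geometry of row vectors *)

Section Euclidean.
Variables (R : realType) (d : nat).
Implicit Types x y z : 'rV[R]_d.

Lemma dotC x y : dot x y = dot y x.
Proof. by apply: eq_bigr => i _; rewrite mulrC. Qed.

Lemma dotDl x y z : dot (x + y) z = dot x z + dot y z.
Proof. by rewrite /dot -big_split; apply: eq_bigr => i _; rewrite mxE mulrDl. Qed.

Lemma dotDr x y z : dot z (x + y) = dot z x + dot z y.
Proof. by rewrite dotC dotDl !(dotC z). Qed.

Lemma dotZl a x y : dot (a *: x) y = a * dot x y.
Proof. by rewrite /dot mulr_sumr; apply: eq_bigr => i _; rewrite mxE mulrA. Qed.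

Lemma dotZr a x y : dot x (a *: y) = a * dot x y.
Proof. by rewrite dotC dotZl dotC. Qed.

Lemma dotNl x y : dot (- x) y = - dot x y.
Proof. by rewrite -scaleN1r dotZl mulN1r. Qed.

Lemma dotNr x y : dot x (- y) = - dot x y.
Proof. by rewrite dotC dotNl dotC. Qed.

Lemma dot_suml (I : finType) (u : I -> 'rV[R]_d) y :
  dot (\sum_i u i) y = \sum_i dot (u i) y.
Proof.
rewrite /dot exchange_big; apply: eq_bigr => i _ /=.
by rewrite summxE mulr_suml.
Qed.

Lemma dot_ge0 x : 0 <= dot x x.
Proof. by apply: sumr_ge0 => i _; rewrite -expr2 sqr_ge0. Qed.

Lemma dot_sqrD x y : dot (x + y) (x + y) = dot x x + 2 * dot x y + dot y y.
Proof. by rewrite dotDl !dotDr (dotC y x); ring. Qed.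

Lemma enorm_ge0 x : 0 <= enorm x.
Proof. exact: sqrtr_ge0. Qed.

Lemma sqr_enorm x : enorm x ^+ 2 = dot x x.
Proof. by rewrite sqr_sqrtr // dot_ge0. Qed.

Lemma enorm0 : enorm (0 : 'rV[R]_d) = 0.
Proof. by rewrite /enorm -(scale0r 0) dotZl mul0r sqrtr0. Qed.

Lemma enormN x : enorm (- x) = enorm x.
Proof. by rewrite /enorm dotNl dotNr opprK. Qed.

Lemma enorm_leP x r : 0 <= r -> (enorm x <= r) = (dot x x <= r ^+ 2).
Proof. by move=> r0; rewrite -sqr_enorm ler_sqr // nnegrE // enorm_ge0. Qed.

Lemma mx_norm_leP x r : 0 <= r -> (forall j, `|x 0 j| <= r) -> `|x| <= r.
Proof.
move=> r0 xr; rewrite /Num.norm /= mx_normrE; apply/bigmax_leP; split=> //= -[i j] _.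
by rewrite ord1; exact: xr.
Qed.

Lemma entry_le_mx_norm x j : `|x 0 j| <= `|x|.
Proof.
by rewrite [leRHS]/Num.norm /= mx_normrE; apply/bigmax_geP; right; exists (0, j).
Qed.

(** Boundedness and convergence in the product topology are checked on the max
norm, whereas all estimates of the argument are Euclidean. *)
Lemma mx_norm_le_enorm x : `|x| <= enorm x.
Proof.
apply: mx_norm_leP (enorm_ge0 x) _ => j.
rewrite -(@ler_sqr _ `|x 0 j|) ?nnegrE ?enorm_ge0 // sqr_enorm /dot (bigD1 j) //=.
rewrite real_normK ?num_real // expr2 lerDl.
by apply: sumr_ge0 => i _; rewrite -expr2 sqr_ge0.
Qed.

(** Cauchy-Schwarz, read off the discriminant of t |-> |y|^2 x - <x, y> y. *)
Lemma dot_le_enorm x y : dot x y <= enorm x * enorm y.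
Proof.
have [y0|y0] := eqVneq (dot y y) 0.
  have yi0 i : y 0 i = 0.
    move/eqP: y0; rewrite /dot psumr_eq0; last by move=> j _; rewrite -expr2 sqr_ge0.
    by move=> /allP /(_ i (mem_index_enum _)); rewrite /= mulf_eq0 orbb => /eqP.
  by rewrite /dot big1 ?mulr_ge0 ?enorm_ge0 // => i _; rewrite yi0 mulr0.
have yp : 0 < dot y y by rewrite lt_def y0 dot_ge0.
have := dot_ge0 (dot y y *: x - dot x y *: y).
rewrite dot_sqrD dotNl !dotNr !dotZl !dotZr => H.
have {}H : 0 <= dot y y * (dot x x * dot y y - dot x y ^+ 2).
  by apply: le_trans H _; rewrite le_eqVlt; apply/orP; left; apply/eqP; ring.
rewrite pmulr_rge0 // subr_ge0 -!sqr_enorm -exprMn in H.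
have [xy0|xy0] := leP (dot x y) 0.
  by apply: le_trans xy0 _; rewrite mulr_ge0 ?enorm_ge0.
by rewrite -ler_sqr // nnegrE ?mulr_ge0 ?enorm_ge0 // ltW.
Qed.

Lemma enormD x y : enorm (x + y) <= enorm x + enorm y.
Proof.
rewrite enorm_leP ?addr_ge0 ?enorm_ge0 // dot_sqrD -!sqr_enorm.
have := dot_le_enorm x y; nra.
Qed.

Lemma enorm_distD x y : enorm x <= enorm (y - x) + enorm y.
Proof.
by rewrite -(enormN (y - x)) opprB; have := enormD (x - y) y; rewrite subrK.
Qed.

End Euclidean.

Lemma dot_pt (R : realType) n (u v : 'rV[R]_n) a b :
  dot (pt u a) (pt v b) = dot u v + a * b.
Proof.
rewrite /dot big_split_ord /= big_ord1; congr (_ + _).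
  by apply: eq_bigr => i _; rewrite !row_mxEl.
by rewrite !row_mxEr !mxE.
Qed.

Lemma ptB (R : realType) n (u v : 'rV[R]_n) a b : pt u a - pt v b = pt (u - v) (a - b).
Proof. by rewrite /pt opp_row_mx add_row_mx raddfB. Qed.

Lemma ptZ (R : realType) n (u : 'rV[R]_n) a c : c *: pt u a = pt (c *: u) (c * a).
Proof. by rewrite /pt scale_row_mx scale_scalar_mx. Qed.

(** * Convergence of row vectors and subsequences *)

Section Convergence.
Variables (R : realType) (d : nat) (T : Type) (F : set_system T).
Context {FF : Filter F}.
Implicit Types (x y : T -> 'rV[R]_d) (a b : 'rV[R]_d).

Lemma cvg_entry x a j : x @ F --> a -> x t 0 j @[t --> F] --> a 0 j.
Proof.
move=> xa.
by apply: (@continuous_cvg _ _ _ _ _ _ (fun v : 'rV[R]_d => v 0 j)) xa; exact: coord_continuous.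
Qed.

Lemma cvg_entries x a : (forall j, x t 0 j @[t --> F] --> a 0 j) -> x @ F --> a.
Proof.
move=> xa; apply/cvgrPdist_le => e e0.
have : \forall t \near F, forall j, `|a 0 j - x t 0 j| <= e.
  apply: filter_forall => j; by move/cvgrPdist_le : (xa j); apply.
apply: filterS => t H; apply: mx_norm_leP (ltW e0) _ => j.
by rewrite !mxE; exact: H.
Qed.

Lemma cvg_sumv (V : normedModType R) (I : finType) (f : I -> T -> V) (a : I -> V) :
  (forall i, f i t @[t --> F] --> a i) ->
  \sum_i f i t @[t --> F] --> \sum_i a i.
Proof.
move=> fa; apply: cvg_big => [|i _]; last exact: fa.
exact: add_continuous.
Qed.

Lemma cvg_dot x y a b : x @ F --> a -> y @ F --> b ->
  dot (x t) (y t) @[t --> F] --> dot a b.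
Proof.
by move=> xa yb; apply: cvg_sumv => j; apply: cvgM; exact: cvg_entry.
Qed.

Lemma cvg_enorm x a : x @ F --> a -> enorm (x t) @[t --> F] --> enorm a.
Proof.
move=> xa; apply: (@continuous_cvg _ _ _ _ _ _ (@Num.sqrt R)) (cvg_dot xa xa).
exact: sqrt_continuous.
Qed.

End Convergence.

Section Subsequences.
Variable R : realType.

Lemma increasing_seq_cvgny (f : nat -> nat) : increasing_seq f -> f @ \oo --> \oo.
Proof.
move=> fi; have fk k : (k <= f k)%N.
  elim: k => // k IH; apply: leq_ltn_trans IH _.
  by have /increasing_seqP/(_ k) := fi; rewrite ltEnat.
apply/cvgnyPge => N; near=> k; apply: leq_trans (fk k).
by near: k; exact: nbhs_infty_ge.
Unshelve. all: by end_near. Qed.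

(** One extraction per member of the family: each later extraction preserves
the limits already obtained. *)
Lemma bounded_family_subseq (I : finType) (a : I -> nat -> R) (B : R) :
  (forall i k, `|a i k| <= B) ->
  exists2 s : nat -> nat, s @ \oo --> \oo & forall i, cvgn (a i \o s).
Proof.
move=> aB.
suff H (r : seq I) : exists2 s : nat -> nat, s @ \oo --> \oo &
    forall i, i \in r -> cvgn (a i \o s).
  by have [s ss cs] := H (enum I); exists s => // i; apply: cs; rewrite mem_enum.
elim: r => [|i r [s soo cs]]; first by exists id => //; exact: cvg_id.
have [|t ti ct] := @bolzano_weierstrass R (a i \o s).
  by exists B; split; [exact: num_real|move=> M BM k _ /=; apply: le_trans (aB _ _) (ltW BM)].
have too := increasing_seq_cvgny ti.
exists (s \o t); first exact: cvg_comp too soo.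
move=> j; rewrite inE => /predU1P[->|jr]; first exact: ct.
apply/cvg_ex; have /cvg_ex [l sl] := cs j jr; exists l.
exact: (@cvg_comp _ _ _ t (a j \o s) _ _ _ too sl).
Qed.

Lemma bounded_vectors_subseq (I : finType) d (w : I -> nat -> 'rV[R]_d) (B : R) :
  (forall i k, `|w i k| <= B) ->
  exists s : nat -> nat, s @ \oo --> \oo /\
    exists l : I -> 'rV[R]_d, forall i, w i (s k) @[k --> \oo] --> l i.
Proof.
move=> wB.
have [|s soo cs] := @bounded_family_subseq (I * 'I_d)%type
    (fun ij k => w ij.1 k 0 ij.2) B.
  by move=> ij k; apply: le_trans (entry_le_mx_norm _ _) (wB _ _).
exists s; split => //.
exists (fun i => \row_j lim (w i (s k) 0 j @[k --> \oo])) => i.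
by apply: cvg_entries => j; rewrite mxE; exact: (cs (i, j)).
Qed.

End Subsequences.

(** * Normal cones *)

Section NormalCones.
Variables (R : realType) (d : nat).
Implicit Types (x v : 'rV[R]_d) (C : set 'rV[R]_d).

(** The minimality conditions used below come with quadratic error terms, so
they produce normals of this smaller and more explicit kind. *)
Definition proximal_normal x C : set 'rV[R]_d :=
  [set v | exists sigma : R, forall y, C y ->
     dot v (y - x) <= sigma * dot (y - x) (y - x)].

(** Within distance e / (|sigma| + 1) the quadratic error is at most
e |y - x|. *)
Lemma proximal_frechet x C v : proximal_normal x C v -> frechet_normal_cone x C v.
Proof.
move=> [sigma H]; rewrite /frechet_normal_cone /= /limf_esup.
apply/lee_addgt0Pr => e e0; rewrite add0e.
have M0 : 0 < `|sigma| + 1 by rewrite ltr_wpDl.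
apply: ge_ereal_inf; exists (ereal_sup ((fun y => (dot v (y - x) / enorm (y - x))%:E) @`
   [set y | C y /\ enorm (y - x) < e / (`|sigma| + 1)])).
  exists [set y | C y /\ enorm (y - x) < e / (`|sigma| + 1)] => //.
  have E : (fun y => enorm (y - x)) @ x --> (0 : R).
    rewrite -(@enorm0 R d) -(subrr x).
    apply: (@cvg_enorm _ _ _ (nbhs x) _ (fun y : 'rV[R]_d => y - x)).
    by apply: cvgB; [exact: cvg_id|exact: cvg_cst].
  have D : (fun y => enorm (y - x)) @ x^' --> (0 : R).
    by apply: cvg_trans E; apply: cvg_app; exact: nbhs_dnbhs.
  have N : \forall y \near x^', enorm (y - x) < e / (`|sigma| + 1).
    by apply: (@cvgr_lt _ _ _ _ _ 0 D); rewrite divr_gt0.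
  by rewrite /within /=; apply: filterS N => y yN Cy.
apply: ge_ereal_sup => _ [y [Cy yd] <-]; rewrite lee_fin.
have [->|y0] := eqVneq (enorm (y - x)) 0; first by rewrite invr0 mulr0 ltW.
have yp : 0 < enorm (y - x) by rewrite lt_def y0 enorm_ge0.
rewrite ler_pdivrMr //; apply: le_trans (H y Cy) _.
rewrite -sqr_enorm expr2 mulrA ler_pM2r //.
apply: le_trans (_ : (`|sigma| + 1) * enorm (y - x) <= _).
  by rewrite ler_pM2r //; apply: le_trans (ler_norm _) _; rewrite lerDl.
by rewrite mulrC -ler_pdivlMr // ltW.
Qed.

Lemma frechet_scale x C v t :
  0 < t -> frechet_normal_cone x C v -> frechet_normal_cone x C (t *: v).
Proof.
rewrite /frechet_normal_cone /= /limf_esup => t0 H.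
apply/lee_addgt0Pr => e e0; rewrite add0e.
have [|_ [V FV <-] Ve] := @ereal_inf_lt R _ (e / t)%:E (le_lt_trans H _).
  by rewrite lte_fin divr_gt0.
apply: ge_ereal_inf; eexists; first by exists V.
apply: ge_ereal_sup => _ [y Vy <-]; rewrite lee_fin dotZl -mulrA.
rewrite mulrC -ler_pdivlMr // -lee_fin.
by apply: le_trans (ltW Ve); apply: ereal_sup_ubound; exists y.
Qed.

Lemma limiting_scale x C v t :
  0 < t -> limiting_normal_cone x C v -> limiting_normal_cone x C (t *: v).
Proof.
move=> t0 [x_ [v_ [Cx xx vN vv]]]; exists x_, (fun k => t *: v_ k); split => //.
  by move=> k; exact: frechet_scale.
by apply: cvgZ => //; exact: cvg_cst.
Qed.

Lemma frechet_limiting x C v :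
  C x -> frechet_normal_cone x C v -> limiting_normal_cone x C v.
Proof.
by move=> Cx vN; exists (fun=> x), (fun=> v); split => //; exact: cvg_cst.
Qed.

Lemma normal_cone_infty_scale C v t :
  0 < t -> normal_cone_infty C v -> normal_cone_infty C (t *: v).
Proof.
move=> t0 [x_ [v_ [Cx xoo vN vv]]]; exists x_, (fun k => t *: v_ k); split => //.
  by move=> k; exact: frechet_scale.
by apply: cvgZ => //; exact: cvg_cst.
Qed.

End NormalCones.

Lemma epi_normals_infty_scale (R : realType) n (f : 'rV[R]_n -> \bar R) w t :
  0 < t -> epi_normals_infty f w -> epi_normals_infty f (t *: w).
Proof.
move=> t0 [x_ [w_ [Dx xoo wN ww]]]; exists x_, (fun k => t *: w_ k); split => //.
  by move=> k; exact: limiting_scale.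
by apply: cvgZ => //; exact: cvg_cst.
Qed.

(** * The penalised problem and its minimisers *)

Lemma lsc_le_lim (R : realType) (T : topologicalType) (g : T -> R) (y : nat -> T) yl
    (t : nat -> R) tl :
  lower_semicontinuous (EFin \o g) -> y @ \oo --> yl -> t @ \oo --> tl ->
  (forall k, g (y k) <= t k) -> g yl <= tl.
Proof.
move=> glsc yyl ttl gt; rewrite leNgt; apply/negP => tg.
have [|V Vyl gV] := glsc yl ((tl + g yl) / 2).
  by rewrite lte_fin /=; lra.
have V1 : \forall k \near \oo, V (y k) by exact: yyl.
have V2 : \forall k \near \oo, t k < (tl + g yl) / 2.
  by apply: (cvgr_lt tl) ttl _ _; lra.
have [k [Vk tk]] := filter_ex (filterI V1 V2).
by have := gV _ Vk; rewrite lte_fin /=; have := gt k; lra.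
Qed.

(** A crude bound that avoids square roots: C <= (C + 1)^2 for C >= 0. *)
Lemma mx_norm_le_of_dot (R : realType) d (z : 'rV[R]_d) C :
  dot z z <= C -> `|z| <= C + 1.
Proof.
move=> zC; have C0 : 0 <= C by apply: le_trans (dot_ge0 z) zC.
apply: le_trans (mx_norm_le_enorm z) _; rewrite enorm_leP ?addr_ge0 //.
by apply: le_trans zC _; nra.
Qed.

Section Penalisation.
Variables (R : realType) (n m : nat).
Variables (g : 'I_m -> 'rV[R]_n -> R) (Omega : set 'rV[R]_n).
Variables (c rho : R) (x0 : 'rV[R]_n).
Implicit Types (x : 'rV[R]_n) (y : 'I_m -> 'rV[R]_n).

Definition violation y : 'rV[R]_m := \row_i Num.max (g i (y i)) 0.

Definition proximity x y : R :=
  c * dot (x - x0) (x - x0) + rho * \sum_i dot (y i - x) (y i - x).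

(** The Euclidean norm of the violations, rather than their sum, is used because
it is differentiable in the values g_i (y_i) as soon as one of them is positive; it is not
squared, so that its gradient keeps norm 1 however small the violations. *)
Definition penalised x y : R := enorm (violation y) + proximity x y.

Hypotheses (c0 : 0 < c) (rho0 : 0 < rho).

Lemma violation_ge0 y i : 0 <= violation y 0 i.
Proof. by rewrite mxE le_max lexx orbT. Qed.

Lemma proximity_x_bound x y : c * dot (x - x0) (x - x0) <= proximity x y.
Proof.
rewrite lerDl mulr_ge0 ?(ltW rho0) //.
by apply: sumr_ge0 => i _; exact: dot_ge0.
Qed.

Lemma proximity_y_bound x y i : rho * dot (y i - x) (y i - x) <= proximity x y.
Proof.
apply: le_trans (_ : rho * \sum_i dot (y i - x) (y i - x) <= _); last first.
  by rewrite lerDr mulr_ge0 ?(ltW c0) // dot_ge0.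
rewrite ler_pM2l // (bigD1 i) //= lerDl.
by apply: sumr_ge0 => j _; exact: dot_ge0.
Qed.

Lemma proximity_ge0 x y : 0 <= proximity x y.
Proof. by apply: le_trans (proximity_x_bound x y); rewrite mulr_ge0 ?(ltW c0) ?dot_ge0. Qed.

Lemma penalised_ge0 x y : 0 <= penalised x y.
Proof. by rewrite addr_ge0 ?enorm_ge0 ?proximity_ge0. Qed.

(** The direct method. Along a minimising sequence the violations are bounded, hence
may be assumed to converge together with the points; semicontinuity only bounds the
violations of the limit point by the limits t of the violations, which suffices
because the objective is continuous and nondecreasing in the violations. *)
Lemma exists_penalised_minimizer :
  (forall i, lower_semicontinuous (EFin \o g i)) -> closed Omega -> Omega x0 ->
  exists x y, Omega x /\ forall x' y', Omega x' -> penalised x y <= penalised x' y'.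
Proof.
move=> glsc Ocl Ox0.
pose E := [set penalised p.1 p.2 | p in [set p : 'rV[R]_n * ('I_m -> 'rV[R]_n) | Omega p.1]].
have lbE : lbound E 0 by move=> _ [p _ <-]; exact: penalised_ge0.
have infE : has_inf E.
  by split; [exists (penalised x0 (fun=> x0)), (x0, fun=> x0)|exists 0].
have /choice[p_ Hp] k : exists p : 'rV[R]_n * ('I_m -> 'rV[R]_n),
    Omega p.1 /\ penalised p.1 p.2 < inf E + harmonic k.
  by have [_ [p Op <-] pE] := @inf_adherent R E (harmonic k) (harmonic_gt0 k) infE; exists p.
have pB k : penalised (p_ k).1 (p_ k).2 <= inf E + 1.
  apply: le_trans (ltW (Hp k).2) _; rewrite lerD2l /harmonic /=.
  by rewrite invf_le1 ?ler1n // ltr0n.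
set B := inf E + 1 in pB.
pose w (o : option 'I_m) k := if o is Some i then (p_ k).2 i else (p_ k).1.
pose Bx := `|x0| + (B / c + 1).
have B0 : 0 <= B by apply: le_trans (penalised_ge0 _ _) (pB 0%N).
have xB k : `|(p_ k).1| <= Bx.
  rewrite -{1}(subrK x0 (p_ k).1) addrC; apply: le_trans (ler_normD _ _) _.
  rewrite lerD2l; apply: mx_norm_le_of_dot; rewrite ler_pdivlMr // mulrC.
  apply: le_trans (proximity_x_bound _ (p_ k).2) _.
  by apply: le_trans (pB k); rewrite lerDr enorm_ge0.
have wB o k : `|w o k| <= Bx + (B / rho + 1).
  case: o => [i|] /=; last by apply: le_trans (xB k) _; rewrite lerDl addr_ge0 ?divr_ge0 ?(ltW rho0).
  rewrite -{1}(subrK (p_ k).1 ((p_ k).2 i)) addrC; apply: le_trans (ler_normD _ _) _.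
  apply: lerD (xB k) _; apply: mx_norm_le_of_dot; rewrite ler_pdivlMr // mulrC.
  apply: le_trans (proximity_y_bound _ _ i) _.
  by apply: le_trans (pB k); rewrite lerDr enorm_ge0.
have [s1 [s1oo [l wl]]] := bounded_vectors_subseq wB.
have [s2 [s2oo [t vt]]] := @bounded_vectors_subseq R unit m
  (fun _ k => violation (p_ (s1 k)).2) B (fun _ k => le_trans (mx_norm_le_enorm _)
    (le_trans (ler_wpDr (proximity_ge0 _ _) (lexx _)) (pB _))).
have {}vt := vt tt.
pose x k := (p_ (s1 (s2 k))).1; pose y i k := (p_ (s1 (s2 k))).2 i.
have xl : x @ \oo --> l None.
  exact: (@cvg_comp _ _ _ s2 (w None \o s1) _ _ _ s2oo (wl None)).
have yl i : y i @ \oo --> l (Some i).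
  exact: (@cvg_comp _ _ _ s2 (w (Some i) \o s1) _ _ _ s2oo (wl (Some i))).
exists (l None), (fun i => l (Some i)); split.
  by apply: (closed_cvg _ Ocl _ _ xl); near=> k; exact: (Hp _).1.
move=> x' y' Ox'; apply: le_trans (_ : inf E <= _); last first.
  by apply: ge_inf; [exists 0|exists (x', y')].
have vl i : Num.max (g i (l (Some i))) 0 <= t tt 0 i.
  have vti : violation (p_ (s1 (s2 k))).2 0 i @[k --> \oo] --> t tt 0 i.
    exact: cvg_entry vt.
  rewrite ge_max; apply/andP; split.
    apply: (lsc_le_lim (glsc i) (yl i) vti) => k.
    by rewrite mxE le_max lexx.
  apply: (ler_cvg_to (cvg_cst 0) vti).
  by near=> k; exact: violation_ge0.
apply: le_trans (_ : enorm (t tt) + proximity (l None) (fun i => l (Some i)) <= _).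
  rewrite lerD2r enorm_leP ?enorm_ge0 // sqr_enorm; apply: ler_sum => i _.
  by rewrite ler_pM ?violation_ge0 // mxE vl.
have cvgp : penalised (x k) (fun i => y i k) @[k --> \oo] -->
    enorm (t tt) + proximity (l None) (fun i => l (Some i)).
  apply: cvgD; first exact: cvg_enorm vt.
  have hx : x k - x0 @[k --> \oo] --> l None - x0 by apply: cvgB xl (cvg_cst _).
  have hy i : y i k - x k @[k --> \oo] --> l (Some i) - l None by apply: cvgB (yl i) xl.
  apply: cvgD.
    by apply: cvgM; [exact: cvg_cst|exact: (cvg_dot hx hx)].
  apply: cvgM; first exact: cvg_cst.
  by apply: cvg_sumv => i; exact: (cvg_dot (hy i) (hy i)).
have cvgh : inf E + harmonic (s1 (s2 k)) @[k --> \oo] --> inf E.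
  rewrite -{2}[inf E]addr0; apply: cvgD; first exact: cvg_cst.
  apply: (@cvg_comp _ _ _ (s1 \o s2) harmonic _ \oo _); last exact: cvg_harmonic.
  exact: cvg_comp s2oo s1oo.
apply: (ler_cvg_to cvgp cvgh).
by near=> k; exact: ltW (Hp _).2.
Unshelve. all: by end_near. Qed.

End Penalisation.

(** * Approximate multipliers at points far from the solution set *)

(** Otherwise there are x_k in Omega within r of x0 and copies y_k whose distance
to x_k tends to 0 and whose constraint values are nonpositive; by semicontinuity a
cluster point of x_k lies in the solution set, within r of x0. *)
Lemma infeasible_near (R : realType) n m (g : 'I_m -> 'rV[R]_n -> R) (Omega : set 'rV[R]_n)
    (x0 : 'rV[R]_n) (r : R) :
  (forall i, lower_semicontinuous (EFin \o g i)) -> closed Omega -> 0 <= r ->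
  (forall s, solution_set Omega g s -> r < enorm (s - x0)) ->
  exists delta : R, [/\ 0 < delta, delta <= 1 & forall x (y : 'I_m -> 'rV[R]_n), Omega x -> enorm (x - x0) <= r ->
    (forall i, enorm (y i - x) <= delta) -> exists i, 0 < g i (y i)].
Proof.
move=> glsc Ocl r0 Sfar; apply: contrapT => H.
have /choice[p_ Hp] k : exists p : 'rV[R]_n * ('I_m -> 'rV[R]_n),
    [/\ Omega p.1, enorm (p.1 - x0) <= r, forall i, enorm (p.2 i - p.1) <= harmonic k &
        forall i, g i (p.2 i) <= 0].
  apply: contrapT => Hk; apply: H; exists (harmonic k); split.
  - exact: harmonic_gt0.
  - by rewrite /harmonic /= invf_le1 ?ler1n // ltr0n.
  - move=> x y Ox xr yx; apply: contrapT => gy; apply: Hk; exists (x, y); split => //.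
    by move=> i; rewrite leNgt; apply/negP => gi; apply: gy; exists i.
have xB (_ : unit) k : `|(p_ k).1| <= `|x0| + r.
  rewrite -{1}(subrK x0 (p_ k).1) addrC; apply: le_trans (ler_normD _ _) _.
  rewrite lerD2l; apply: le_trans (mx_norm_le_enorm _) _.
  by have [_ + _ _] := Hp k.
have [s [soo [l xl]]] := bounded_vectors_subseq xB.
have {}xl := xl tt; set X := l tt in xl.
have hs : harmonic (s k) @[k --> \oo] --> (0 : R).
  by apply: (@cvg_comp _ _ _ s harmonic _ \oo _) => //; exact: cvg_harmonic.
have yl i : (p_ (s k)).2 i @[k --> \oo] --> X.
  rewrite -[X]add0r.
  rewrite (_ : (fun k => _) = fun k => ((p_ (s k)).2 i - (p_ (s k)).1) + (p_ (s k)).1).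
    2: by apply/funext => k; rewrite subrK.
  apply: cvgD xl; apply/cvgrPdist_le => e e0.
  have he : \forall k \near \oo, harmonic (s k) <= e by apply: (cvgr_le 0) hs _ e0.
  apply: filterS he => k ke; rewrite sub0r normrN; apply: le_trans ke.
  apply: le_trans (mx_norm_le_enorm _) _.
  by have [_ _ + _] := Hp (s k); apply.
have OX : Omega X.
  by apply: (closed_cvg _ Ocl _ _ xl); near=> k; have [] := Hp (s k).
suff : enorm (X - x0) <= r.
  rewrite leNgt => /negP; apply; apply: Sfar; split => // i.
  apply: (lsc_le_lim (glsc i) (yl i) (cvg_cst 0)) => k.
  by have [_ _ _] := Hp (s k); apply.
have dX : enorm ((p_ (s k)).1 - x0) @[k --> \oo] --> enorm (X - x0).
  by apply: cvg_enorm; apply: cvgB xl (cvg_cst _).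
apply: (ler_cvg_to dX (cvg_cst r)).
by near=> k; have [] := Hp (s k).
Unshelve. all: by end_near. Qed.

Lemma enorm_le_sum (R : realType) d (x : 'rV[R]_d) :
  (forall i, 0 <= x 0 i) -> enorm x <= \sum_i x 0 i.
Proof.
move=> x0; rewrite enorm_leP ?sumr_ge0 // expr2 mulr_suml; apply: ler_sum => i _.
by rewrite ler_wpM2l // (bigD1 i) //= lerDl sumr_ge0.
Qed.

Section MinimiserNormals.
Variables (R : realType) (n m : nat).
Variables (g : 'I_m -> 'rV[R]_n -> R) (Omega : set 'rV[R]_n).
Variables (c rho : R) (x0 x : 'rV[R]_n) (y : 'I_m -> 'rV[R]_n).
Hypothesis rho0 : 0 < rho.
Hypothesis xy_min : forall x' y', Omega x' ->
  penalised g c rho x0 x y <= penalised g c rho x0 x' y'.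

Let u i := (2 * rho) *: (x - y i).

(** Only x moves, so the terms that vary are quadratic polynomials in x, and the
normal is minus their gradient. *)
Lemma minimiser_set_normal : proximal_normal x Omega (- ((2 * c) *: (x - x0)) - \sum_i u i).
Proof.
exists (c + rho * m%:R) => x' Ox'; have := xy_min y Ox'.
set h := x' - x; rewrite lerD2l /proximity.
have -> : x' - x0 = (x - x0) + h by rewrite /h [RHS]addrC addrA subrK.
rewrite (dot_sqrD (x - x0) h).
have -> : \sum_i dot (y i - x') (y i - x') =
  \sum_i dot (y i - x) (y i - x) + m%:R * dot h h + 2 * \sum_i dot (x - y i) h.
  have -> : m%:R * dot h h = \sum_(i < m) dot h h by rewrite sumr_const card_ord mulr_natl.
  rewrite mulr_sumr -!big_split /=.
  apply: eq_bigr => i _.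
  have -> : y i - x' = (y i - x) - h by rewrite /h opprB addrA subrK.
  by rewrite dot_sqrD dotNl !dotNr opprK -(opprB (y i) x) dotNl; ring.
move=> H; rewrite dotDl !dotNl dotZl dot_suml.
have -> : \sum_i dot (u i) h = 2 * rho * \sum_i dot (x - y i) h.
  by rewrite mulr_sumr; apply: eq_bigr => i _; rewrite dotZl.
rewrite -subr_ge0 in H; rewrite -subr_ge0.
apply: le_trans H _; rewrite le_eqVlt; apply/orP; left; apply/eqP; ring.
Qed.

(** Only the i-th copy moves. The norm of the violations is majorised by a
quadratic that touches it at the minimiser, s <= (s^2 + r^2) / (2 r), and the i-th squared
violation by (tau + (a - t))^2 on the epigraph; so minimality survives with an
objective quadratic in (y', a), whose gradient is the normal. *)
Lemma minimiser_epi_normal i :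
  Omega x -> 0 < enorm (violation g y) ->
  proximal_normal (pt (y i) (g i (y i))) (epi (EFin \o g i))
    (pt (u i) (- (violation g y 0 i / enorm (violation g y)))).
Proof.
set r := enorm (violation g y) => Ox r0.
exists (rho + (2 * r)^-1) => _ [y' [a [-> /= ga]]]; rewrite lee_fin in ga.
pose y2 j := if j == i then y' else y j.
rewrite ptB !dot_pt dotZl; set h := y' - y i; set t := g i (y i) in ga *.
set tau := violation g y 0 i.
have := xy_min y2 Ox; rewrite /penalised -/r /proximity => H.
have E1 : \sum_j dot (y2 j - x) (y2 j - x) =
    \sum_j dot (y j - x) (y j - x) + 2 * dot (y i - x) h + dot h h.
  rewrite (bigD1 i) //= [in RHS](bigD1 i) //= /y2 eqxx.
  have -> : y' - x = (y i - x) + h by rewrite /h [RHS]addrC addrA subrK.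
  rewrite (dot_sqrD (y i - x) h) (eq_bigr (fun j => dot (y j - x) (y j - x))); last first.
    by move=> j /negbTE ->.
  by ring.
pose tau' := violation g y2 0 i.
have E2 : enorm (violation g y2) ^+ 2 = r ^+ 2 - tau ^+ 2 + tau' ^+ 2.
  rewrite !sqr_enorm /dot (bigD1 i) //= [in RHS](bigD1 i) //= -/tau -/tau'.
  rewrite (eq_bigr (fun j => violation g y 0 j * violation g y 0 j)); last first.
    by move=> j /negbTE ji; rewrite !mxE /y2 ji.
  by ring.
(* tau = max(t, 0) >= t and a >= g_i(y'), so tau + (a - t) >= a >= g_i(y'). *)
have T1 : tau' ^+ 2 <= (tau + (a - t)) ^+ 2.
  have tt : t <= tau by rewrite /tau mxE le_max lexx.
  have -> : tau' = Num.max (g i y') 0 by rewrite /tau' mxE /y2 eqxx.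
  case: (leP (g i y') 0) => g0; first by rewrite expr0n sqr_ge0.
  by rewrite ler_sqr ?nnegrE; lra.
(* Expanding (|violation g y2| - r)^2 >= 0. *)
have E3 : 2 * r * enorm (violation g y2) <= enorm (violation g y2) ^+ 2 + r ^+ 2.
  have := sqr_ge0 (enorm (violation g y2) - r); nra.
have E4 : 2 * r * (r + rho * \sum_j dot (y j - x) (y j - x)) <=
    2 * r * (enorm (violation g y2) + rho * \sum_j dot (y2 j - x) (y2 j - x)).
  rewrite ler_pM2l ?mulr_gt0 //. by rewrite addrCA [leRHS]addrCA lerD2l in H.
rewrite E1 in E4.
have -> : dot (x - y i) h = - dot (y i - x) h by rewrite -dotNl opprB.
rewrite -(ler_pM2l (_ : 0 < 2 * r)); last by lra.
have -> : 2 * r * (2 * rho * - dot (y i - x) h + - (tau / r) * (a - t)) =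
   2 * r * (2 * rho * - dot (y i - x) h) - 2 * tau * (a - t).
  by field; rewrite gt_eqF.
have -> : 2 * r * ((rho + (2 * r)^-1) * (dot h h + (a - t) * (a - t))) =
   (2 * r * rho + 1) * (dot h h + (a - t) * (a - t)).
  by field; rewrite gt_eqF.
have := dot_ge0 h; have : 0 <= r * rho * (a - t) ^+ 2.
  exact: mulr_ge0 (mulr_ge0 (ltW r0) (ltW rho0)) (sqr_ge0 _).
rewrite E2 in E3; nra.
Qed.

End MinimiserNormals.

(** The normals of a minimiser of the penalised problem around x0. Comparing with
the value at x0, which is at most eps * d, bounds both c |x - x0|^2 and
rho |y_i - x|^2 by eps * d. *)
Lemma approximate_multipliers (R : realType) n m (g : 'I_m -> 'rV[R]_n -> R)
    (Omega : set 'rV[R]_n) x0 (d eps : R) :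
  (forall i, lower_semicontinuous (EFin \o g i)) -> closed Omega -> Omega x0 ->
  0 < d -> 0 < eps ->
  (forall s, solution_set Omega g s -> d <= enorm (s - x0)) ->
  \sum_i Num.max (g i x0) 0 <= eps * d ->
  exists (x : 'rV[R]_n) (y : 'I_m -> 'rV[R]_n) (lam : 'I_m -> R) u v,
    [/\ Omega x /\ enorm (x - x0) <= d / 2,
        forall i, enorm (y i - x) <= 1,
        (forall i, 0 <= lam i) /\ 1 <= \sum_i lam i,
        forall i, proximal_normal (pt (y i) (g i (y i))) (epi (EFin \o g i)) (pt (u i) (- lam i)) &
        proximal_normal x Omega v /\ enorm (\sum_i u i + v) <= 4 * eps].
Proof.
move=> glsc Ocl Ox0 d0 e0 Sfar sumg.
have [||delta [del0 del1 infeas]] := @infeasible_near _ _ _ g Omega x0 (d / 2) glsc Ocl.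
- by lra.
- by move=> s /Sfar; lra.
(* These constants solve c (d / 2)^2 = eps d and rho delta^2 = eps d. *)
pose c := 4 * eps / d; pose rho := eps * d / delta ^+ 2.
have c0 : 0 < c by rewrite divr_gt0 // mulr_gt0.
have rho0 : 0 < rho by rewrite divr_gt0 ?exprn_gt0 // mulr_gt0.
have [x [y [Ox xy_min]]] := exists_penalised_minimizer c0 rho0 glsc Ocl Ox0.
have pB : penalised g c rho x0 x y <= eps * d.
  apply: le_trans (xy_min x0 (fun=> x0) Ox0) _; apply: le_trans sumg.
  rewrite /penalised /proximity subrr -(scale0r 0) dotZl mul0r big1 // !mulr0 !addr0.
  apply: le_trans (enorm_le_sum _) _; first exact: violation_ge0.
  by apply: ler_sum => i _; rewrite mxE.
have qB : proximity c rho x0 x y <= eps * d.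
  by apply: le_trans pB; rewrite lerDr enorm_ge0.
have xd : enorm (x - x0) <= d / 2.
  rewrite enorm_leP; last by lra.
  rewrite -(ler_pM2l c0); apply: le_trans (proximity_x_bound c x0 rho0 x y) _.
  by apply: le_trans qB _; rewrite le_eqVlt /c; apply/orP; left; apply/eqP; field; rewrite gt_eqF.
have yd i : enorm (y i - x) <= delta.
  rewrite enorm_leP ?(ltW del0) // -(ler_pM2l rho0).
  apply: le_trans (proximity_y_bound x0 c0 rho0 x y i) _.
  by apply: le_trans qB _; rewrite le_eqVlt /rho; apply/orP; left; apply/eqP; field; rewrite gt_eqF.
have [i0 gi0] := infeas x y Ox xd yd.
have r0 : 0 < enorm (violation g y).
  apply: lt_le_trans (mx_norm_le_enorm _).
  apply: lt_le_trans (entry_le_mx_norm _ i0).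
  by rewrite mxE max_l ?(ltW gi0) // gtr0_norm.
exists x, y, (fun i => violation g y 0 i / enorm (violation g y)),
  (fun i => (2 * rho) *: (x - y i)),
  (- ((2 * c) *: (x - x0)) - \sum_i (2 * rho) *: (x - y i)); split => //.
- by move=> i; apply: le_trans (yd i) del1.
- split=> [i|]; first by rewrite divr_ge0 ?violation_ge0 ?enorm_ge0.
  rewrite -mulr_suml ler_pdivlMr // mul1r; apply: enorm_le_sum; exact: violation_ge0.
- by move=> i; exact: (minimiser_epi_normal rho0 xy_min).
- split; first exact: (minimiser_set_normal xy_min).
  rewrite addrC subrK enormN enorm_leP ?mulr_ge0 ?(ltW e0) // dotZl dotZr.
  rewrite enorm_leP in xd; last by lra.
  apply: le_trans (_ : 2 * c * (2 * c * (d / 2) ^+ 2) <= _).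
    by rewrite !ler_pM2l // mulr_gt0.
  by rewrite le_eqVlt /c; apply/orP; left; apply/eqP; field; rewrite gt_eqF.
Qed.

(** * Multipliers at infinity *)

Section PtCoordinates.
Variables (R : realType) (n : nat).
Implicit Types (u : 'rV[R]_n) (w : 'rV[R]_(n + 1)).

Definition height w : R := w 0 (rshift n 0).

Lemma lsubmx_pt u a : lsubmx (pt u a) = u.
Proof. exact: row_mxKl. Qed.

Lemma height_pt u a : height (pt u a) = a.
Proof. by rewrite /height row_mxEr mxE. Qed.

Lemma pt_eta w : pt (lsubmx w) (height w) = w.
Proof.
rewrite -[RHS]hsubmxK /pt; congr row_mx.
by rewrite [RHS]mx11_scalar mxE.
Qed.

Lemma mx_norm_pt_le u a : `|pt u a| <= `|u| + `|a|.
Proof.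
apply: mx_norm_leP => [|j]; first by rewrite addr_ge0.
case: (split_ordP j) => k ->; rewrite ?row_mxEl ?row_mxEr.
  by apply: le_trans (entry_le_mx_norm u k) _; rewrite lerDl.
by rewrite ord1 mxE mulr1n lerDr.
Qed.

End PtCoordinates.

(** The multipliers of [approximate_multipliers], taken at x0 with |x0| > k + 1
and with eps = 1 / (k + 1), normalised by N >= 1 and passed to the limit along a
subsequence. The component in Omega disappears from the conclusion because the sum of
all components tends to 0. *)
Lemma no_error_bound_multipliers (R : realType) n m (g : 'I_m -> 'rV[R]_n -> R)
    (Omega : set 'rV[R]_n) :
  (forall i, lower_semicontinuous (EFin \o g i)) -> closed Omega ->
  ~ (exists alpha M : R, [/\ 0 < alpha, 0 < M &
    forall x, Omega x -> M < enorm x ->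
      dist_to x (solution_set Omega g) <= alpha * \sum_(i < m) Num.max (g i x) 0]) ->
  exists (lam : 'I_m -> R) (u : 'I_m -> 'rV[R]_n),
    [/\ forall i, 0 <= lam i,
        forall i, epi_normals_infty (EFin \o g i) (pt (u i) (- lam i)),
        normal_cone_infty Omega (- \sum_i u i) &
        \sum_i lam i + \sum_i `|u i| = 1].
Proof.
move=> glsc Ocl noEB.
have sum_ge0 x : 0 <= \sum_i Num.max (g i x) 0.
  by apply: sumr_ge0 => i _; rewrite le_max lexx orbT.
have [s0 Ss0] : exists s, solution_set Omega g s.
  (* If there is no solution, dist_to is the infimum of the empty set, that is 0. *)
  apply: contrapT => S0; apply: noEB; exists 1, 1; split => // x _ _.
  rewrite mul1r (_ : dist_to _ _ = 0) // /dist_to (_ : solution_set Omega g = set0).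
    by rewrite image_set0 inf0.
  by rewrite -subset0 => s Ss; apply: S0; exists s.
(* From |x - x0| <= d / 2 and d <= |s0| + |x0| one gets |x| >= (|x0| - |s0|) / 2;
   the copies lose at most 1 more. *)
pose K k : R := (k.+1%:R - enorm s0) / 2 - 1.
have /choice[q_ Hq] k : exists q : 'rV[R]_n * ('I_m -> 'rV[R]_n) * ('I_m -> R) *
    ('I_m -> 'rV[R]_n) * 'rV[R]_n,
    let: (x, y, lam, u, v) := q in
    [/\ Omega x /\ K k <= enorm x,
        forall i, K k <= enorm (y i),
        (forall i, 0 <= lam i) /\ 1 <= \sum_i lam i,
        forall i, proximal_normal (pt (y i) (g i (y i))) (epi (EFin \o g i)) (pt (u i) (- lam i)) &
        proximal_normal x Omega v /\ enorm (\sum_i u i + v) <= 4 * harmonic k].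
  have [x0 [Ox0 x0k far]] : exists x0, [/\ Omega x0, k.+1%:R < enorm x0 &
      k.+1%:R * \sum_i Num.max (g i x0) 0 < dist_to x0 (solution_set Omega g)].
    apply: contrapT => Hk; apply: noEB; exists k.+1%:R, k.+1%:R.
    split; rewrite ?ltr0n // => x Ox xk; rewrite leNgt; apply/negP => xfar.
    by apply: Hk; exists x.
  set d := dist_to _ _ in far.
  have d0 : 0 < d by apply: le_lt_trans far; rewrite mulr_ge0 ?ler0n.
  have Sfar s : solution_set Omega g s -> d <= enorm (s - x0).
    by move=> Ss; apply: ge_inf; [exists 0 => _ [z _ <-]; exact: enorm_ge0|exists s].
  have ds0 : d <= enorm s0 + enorm x0.
    by apply: le_trans (Sfar _ Ss0) _; apply: le_trans (enormD _ _) _; rewrite enormN.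
  have sumd : \sum_i Num.max (g i x0) 0 <= harmonic k * d.
    by rewrite /harmonic /= mulrC ler_pdivlMr ?ltr0n // mulrC ltW.
  have [x [y [lam [u [v [[Ox xx0] yx Hlam Hu Hv]]]]]] :=
    approximate_multipliers glsc Ocl Ox0 d0 (harmonic_gt0 k) Sfar sumd.
  have xK : K k + 1 <= enorm x by have := enorm_distD x0 x; rewrite /K; lra.
  exists (x, y, lam, u, v); split => //; first by split => //; lra.
  by move=> i; have := enorm_distD x (y i); have := yx i; lra.
pose x k := (q_ k).1.1.1.1; pose y k := (q_ k).1.1.1.2.
pose lam k := (q_ k).1.1.2; pose u k := (q_ k).1.2; pose v k := (q_ k).2.
have {}Hq k : [/\ Omega (x k) /\ K k <= enorm (x k),
        forall i, K k <= enorm (y k i),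
        (forall i, 0 <= lam k i) /\ 1 <= \sum_i lam k i,
        forall i, proximal_normal (pt (y k i) (g i (y k i))) (epi (EFin \o g i))
                    (pt (u k i) (- lam k i)) &
        proximal_normal (x k) Omega (v k) /\ enorm (\sum_i u k i + v k) <= 4 * harmonic k].
  by have := Hq k; rewrite /x /y /lam /u /v; case: (q_ k) => [[[[? ?] ?] ?] ?].
pose N k := \sum_i lam k i + \sum_i `|u k i|.
have N1 k : 1 <= N k.
  have [_ _ [_ lam1] _ _] := Hq k; apply: le_trans lam1 _.
  by rewrite lerDl sumr_ge0.
have N0 k : 0 < N k by apply: lt_le_trans (N1 k).
pose w i k := (N k)^-1 *: pt (u k i) (- lam k i).
have wE i k : w i k = pt ((N k)^-1 *: u k i) ((N k)^-1 * - lam k i) by rewrite /w ptZ.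
have wB i k : `|w i k| <= 1.
  rewrite mx_normZ gtr0_norm ?invr_gt0 // mulrC ler_pdivrMr // mul1r.
  have [_ _ [lam0 _] _ _] := Hq k.
  apply: le_trans (mx_norm_pt_le _ _) _; rewrite normrN (ger0_norm (lam0 i)) addrC.
  apply: lerD; rewrite (bigD1 i) //= lerDl sumr_ge0 //.
have [s [soo [l wl]]] := bounded_vectors_subseq wB.
have ul i : lsubmx (w i (s k)) @[k --> \oo] --> lsubmx (l i).
  apply: cvg_entries => j; rewrite mxE.
  rewrite (_ : (fun k => _) = fun k => w i (s k) 0 (lshift 1 j)).
    exact: cvg_entry (wl i).
  by apply/funext => k; rewrite mxE.
have hl i : height (w i (s k)) @[k --> \oo] --> height (l i) by exact: cvg_entry (wl i).
have Koo : K (s k) @[k --> \oo] --> +oo.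
  apply/cvgryPge => A; near=> k.
  have : 2 * (A + 1) + enorm s0 <= (s k)%:R.
    by near: k; exact: (soo _ (nbhs_infty_ger _)).
  by rewrite /K -(@natr1 _ (s k)); lra.
exists (fun i => - height (l i)), (fun i => lsubmx (l i)); split.
- move=> i; rewrite oppr_ge0.
  apply: (ler_cvg_to (hl i) (cvg_cst 0)); near=> k.
  have [_ _ [lam0 _] _ _] := Hq (s k).
  by rewrite wE height_pt mulrN oppr_le0 mulr_ge0 ?invr_ge0 ?(ltW (N0 _)).
- move=> i; rewrite opprK pt_eta.
  exists (fun k => y (s k) i), (fun k => w i (s k)); split => //.
  + by move=> k; rewrite /edom /= ltry.
  + apply: ger_cvgy Koo; near=> k.
    by have [_ + _ _ _] := Hq (s k); apply.
  + move=> k; apply: frechet_limiting; first by exists (y (s k) i), (g i (y (s k) i)).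
    apply: frechet_scale; first by rewrite invr_gt0.
    by apply: proximal_frechet; have [_ _ _ + _] := Hq (s k); apply.
- exists (x \o s), (fun k => (N (s k))^-1 *: v (s k)); split.
  + by move=> k; have [[]] := Hq (s k).
  + apply: ger_cvgy Koo; near=> k.
    by have [[_ +] _ _ _ _] := Hq (s k).
  + move=> k; apply: frechet_scale; first by rewrite invr_gt0.
    by apply: proximal_frechet; have [_ _ _ _ []] := Hq (s k).
  + rewrite -[- _]add0r.
    rewrite (_ : (fun k => _) = fun k =>
      (N (s k))^-1 *: (\sum_i u (s k) i + v (s k)) - \sum_i lsubmx (w i (s k))); last first.
      apply/funext => k.
      have -> : \sum_i lsubmx (w i (s k)) = (N (s k))^-1 *: \sum_i u (s k) i.
        by rewrite scaler_sumr; apply: eq_bigr => i _; rewrite wE lsubmx_pt.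
      by rewrite scalerDr [X in X - _]addrC addrK.
    apply: cvgB; last exact: cvg_sumv.
    apply/cvgrPdist_le => e e0.
    have hs : harmonic (s k) @[k --> \oo] --> (0 : R).
      by apply: (@cvg_comp _ _ _ s harmonic _ \oo _) => //; exact: cvg_harmonic.
    have he : \forall k \near \oo, harmonic (s k) <= e / 4.
      by apply: (cvgr_le 0) hs _ _; rewrite divr_gt0.
    apply: filterS he => k ke; rewrite sub0r normrN mx_normZ.
    have [_ _ _ _ [_ small]] := Hq (s k).
    rewrite gtr0_norm ?invr_gt0 // mulrC ler_pdivrMr //.
    apply: le_trans (_ : e * 1 <= _); last by rewrite ler_pM2l.
    by have := mx_norm_le_enorm (\sum_i u (s k) i + v (s k)); lra.
- rewrite sumrN.
  have L : - \sum_i height (w i (s k)) + \sum_i `|lsubmx (w i (s k))| @[k --> \oo] -->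
      - \sum_i height (l i) + \sum_i `|lsubmx (l i)|.
    apply: cvgD; first by apply: cvgN; exact: cvg_sumv.
    by apply: cvg_sumv => i; apply: cvg_norm.
  rewrite (_ : (fun k => _) = fun k => 1) in L.
    exact: (norm_cvg_unique L (cvg_cst _)).
  apply/funext => k; rewrite -sumrN -(mulVf (lt0r_neq0 (N0 (s k)))) mulrDr !mulr_sumr.
  congr (_ + _); apply: eq_bigr => i _; rewrite wE ?height_pt ?lsubmx_pt.
    by rewrite mulrN opprK.
  by rewrite mx_normZ gtr0_norm ?invr_gt0.
Unshelve. all: by end_near. Qed.

(** * The error bound *)

Theorem theorem3p2 (R : realType) (n m : nat)
    (g : 'I_m -> 'rV[R]_n -> R) (Omega : set 'rV[R]_n)
    (g_lsc : forall i, lower_semicontinuous (EFin \o g i))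
    (Omega_closed : closed Omega)
    (Omega_unbounded : unbounded Omega)
    (dom_unbounded :
      unbounded (Omega `&` \bigcap_(i in [set: 'I_m]) edom (EFin \o g i)))
    (qualification : forall (u : 'I_m -> 'rV[R]_n) (v : 'rV[R]_n),
      (forall i, singular_subdiff_infty (EFin \o g i) (u i)) ->
      normal_cone_infty Omega v ->
      \sum_(i < m) u i + v = 0 ->
      v = 0 /\ forall i, u i = 0)
    (no_multiplier : ~ exists2 lam : 'I_m -> R, simplex lam &
      [set x + y | x in minkowski_sum (fun i => circ_subdiff_infty (lam i) (EFin \o g i))
                 & y in normal_cone_infty Omega] 0) :
  exists alpha M : R, [/\ 0 < alpha, 0 < M &
    forall x, Omega x -> M < enorm x ->
      dist_to x (solution_set Omega g) <= alpha * \sum_(i < m) Num.max (g i x) 0].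
Proof.
apply: contrapT => /(no_error_bound_multipliers g_lsc Omega_closed).
move=> [lam [u [lam0 wN vN sum1]]].
pose sigma := \sum_i lam i.
have sigma0 : 0 <= sigma by apply: sumr_ge0 => i _; exact: lam0.
(* For sigma = 0 the limit normals are all horizontal. *)
have [s0|sn0] := eqVneq sigma 0.
  have lam_eq0 i : lam i = 0.
    move/eqP: s0; rewrite psumr_eq0; last by move=> j _; exact: lam0.
    by move=> /allP /(_ i (mem_index_enum _)) /eqP.
  have [||| _ u0] := qualification u (- \sum_i u i).
  - by move=> i; have := wN i; rewrite lam_eq0 oppr0.
  - exact: vN.
  - by rewrite subrr.
  move: sum1; rewrite -/sigma s0 add0r big1 => [|i _]; last by rewrite u0 normr0.
  by move/eqP; rewrite eq_sym oner_eq0.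
have sp : 0 < sigma by rewrite lt_def sn0.
apply: no_multiplier; exists (fun i => lam i / sigma).
  split=> [i|]; first by rewrite divr_ge0.
  by rewrite -mulr_suml divff.
exists (\sum_i sigma^-1 *: u i).
  exists (fun i => sigma^-1 *: u i) => // i /=; rewrite /circ_subdiff_infty.
  have [li|li] := ltP 0 (lam i / sigma).
    have lp : 0 < lam i by move: li; rewrite pmulr_lgt0 // invr_gt0.
    exists ((lam i)^-1 *: u i).
      have := epi_normals_infty_scale (_ : 0 < (lam i)^-1) (wN i).
      rewrite /subdiff_infty /= ptZ mulrN mulVf ?gt_eqF //.
      by apply; rewrite invr_gt0.
    by rewrite scalerA mulrAC divff ?gt_eqF // mul1r.
  have li0 : lam i = 0.
    apply/eqP; rewrite eq_le lam0 andbT.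
    by move: li; rewrite pmulr_lle0 // invr_gt0.
  have := epi_normals_infty_scale (_ : 0 < sigma^-1) (wN i).
  rewrite /singular_subdiff_infty /= ptZ li0 oppr0 mulr0.
  by apply; rewrite invr_gt0.
exists (sigma^-1 *: - \sum_i u i).
  by apply: normal_cone_infty_scale vN; rewrite invr_gt0.
by rewrite scalerN scaler_sumr subrr.
Qed.
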